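(* Let $\mathcal M,\mathcal N$ be $\mathcal C$-actegories, let $\mathbf S=(S,\mu^S,\eta^S)$ be a monad on $\mathcal M$ and $\mathbf T=(T,\mu^T,\eta^T)$ a monad on $\mathcal N$, let $l^S$ (resp. $l^T$) be a distributive law between the $\mathcal C$-action on $\mathcal M$ and $\mathbf S$ (resp. the $\mathcal C$-action on $\mathcal N$ and $\mathbf T$), and let $(K,\zeta^K,\alpha):(\mathbf T,l^T)\to(\mathbf S,l^S)$ be a map of pairs, with $K:\mathcal M\to\mathcal N$. Then for each object $C$ of $\mathcal C$, writing $G^{\mathcal M}=C\lozenge^{\mathcal M}\_$ and $G^{\mathcal N}=C\lozenge^{\mathcal N}\_$, the following equality of natural transformations $TKSG^{\mathcal M}\Rightarrow G^{\mathcal N}KS$ holds: $$G^{\mathcal N}(K\mu^S\circ\alpha S)\circ l^TKS\circ T\zeta^KS\circ TKl^S=\zeta^KS\circ Kl^S\circ(K\mu^S\circ\alpha S)G^{\mathcal M}.$$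
   Context: $\mathcal C$ is a fixed monoidal category with product $\otimes$, unit $\mathbf 1$, associativity isomorphisms $a_{X,Y,Z}:X\otimes(Y\otimes Z)\to(X\otimes Y)\otimes Z$ and unit isomorphisms $l_A:\mathbf 1\otimes A\to A$, $r_A:A\otimes\mathbf 1\to A$. A $\mathcal C$-actegory is a category $\mathcal N$ with a bifunctor $\lozenge=\lozenge^{\mathcal N}:\mathcal C\times\mathcal N\to\mathcal N$ and natural isomorphisms $\Psi_{Q,Q',N}:(Q\otimes Q')\lozenge N\to Q\lozenge(Q'\lozenge N)$, $u_N:\mathbf 1\lozenge N\to N$ such that $\Psi_{Q,Q',Q''\lozenge N}\circ\Psi_{Q\otimes Q',Q'',N}\circ(a_{Q,Q',Q''}\lozenge N)=(Q\lozenge\Psi_{Q',Q'',N})\circ\Psi_{Q,Q'\otimes Q'',N}$, $u_{Q\lozenge N}\circ\Psi_{\mathbf 1,Q,N}=l_Q\lozenge N$, $(Q\lozenge u_N)\circ\Psi_{Q,\mathbf 1,N}=r_Q\lozenge N$. A colax $\mathcal C$-equivariant functor $(F,\zeta):\mathcal M\to\mathcal N$ is a functor $F$ with a binatural transformation $\zeta_{C,M}:F(C\lozenge M)\to C\lozenge F(M)$ such that $u_{F(M)}\circ\zeta_{\mathbf 1,M}=F(u_M)$ and $\Psi_{A,B,F(M)}\circ\zeta_{A\otimes B,M}=(A\lozenge\zeta_{B,M})\circ\zeta_{A,B\lozenge M}\circ F(\Psi_{A,B,M})$. A distributive law between the $\mathcal C$-action on $\mathcal M$ and a monad $(S,\mu,\eta)$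 on $\mathcal M$ is a binatural transformation $l_{C,M}:S(C\lozenge M)\to C\lozenge SM$ making $(S,l)$ a colax $\mathcal C$-equivariant functor and satisfying $l_{C,M}\circ\mu_{C\lozenge M}=(C\lozenge\mu_M)\circ l_{C,SM}\circ S(l_{C,M})$ and $l_{C,M}\circ\eta_{C\lozenge M}=C\lozenge\eta_M$. For fixed $C$ it is viewed as a natural transformation $l:SG\Rightarrow GS$, $G=C\lozenge\_$; similarly $\zeta^K:KG^{\mathcal M}\Rightarrow G^{\mathcal N}K$. A map of pairs $(K,\zeta^K,\alpha):(\mathbf T,l^T)\to(\mathbf S,l^S)$, for $\mathbf S$ on $\mathcal M$ and $\mathbf T$ on $\mathcal N$, is a colax $\mathcal C$-equivariant functor $(K,\zeta^K):\mathcal M\to\mathcal N$ with a natural transformation $\alpha:TK\Rightarrow KS$ such that $\alpha\circ\mu^TK=K\mu^S\circ\alpha S\circ T\alpha$, $\alpha\circ\eta^TK=K\eta^S$, and for all $C$ in $\mathcal C$: $G^{\mathcal N}\alpha\circ l^TK\circ T\zeta^K=\zeta^KS\circ Kl^S\circ\alpha G^{\mathcal M}$. *)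

(* Defs.v *)
Set Implicit Arguments.
Unset Strict Implicit.
Unset Printing Implicit Defensive.

Declare Scope cat_scope.
Delimit Scope cat_scope with cat.
Local Open Scope cat_scope.

Reserved Notation "g ∘ f" (at level 40, left associativity).
Reserved Notation "G ⊙ F" (at level 40, left associativity).
Reserved Notation "β • α" (at level 45, left associativity).
Reserved Notation "F ◁ α" (at level 38, right associativity).
Reserved Notation "α ▷ F" (at level 37, left associativity).
Reserved Notation "F ⇒ G" (at level 70, no associativity).
Reserved Notation "X ⊗ Y" (at level 35, no associativity).
Reserved Notation "f ⊗₁ g" (at level 35, no associativity).
Reserved Notation "Q ◊ N" (at level 36, right associativity).
Reserved Notation "f ◊₁ g" (at level 36, right associativity).

Record Category : Type := {
  obj :> Type;
  hom : obj -> obj -> Type;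
  idm : forall X : obj, hom X X;
  comp : forall X Y Z : obj, hom Y Z -> hom X Y -> hom X Z;
  comp_idl : forall (X Y : obj) (f : hom X Y), comp (idm Y) f = f;
  comp_idr : forall (X Y : obj) (f : hom X Y), comp f (idm X) = f;
  comp_assoc : forall (W X Y Z : obj) (h : hom Y Z) (g : hom X Y) (f : hom W X),
    comp h (comp g f) = comp (comp h g) f
}.

Arguments hom {c} X Y.
Arguments idm {c} X.
Arguments comp {c X Y Z} g f.

Notation "g ∘ f" := (comp g f) : cat_scope.

Definition is_iso {A : Category} {X Y : A} (f : hom X Y) : Prop :=
  exists g : hom Y X, g ∘ f = idm X /\ f ∘ g = idm Y.

Record Functor (A B : Category) : Type := {
  fob :> A -> B;
  fmap : forall X Y : A, hom X Y -> hom (fob X) (fob Y);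
  fmap_id : forall X : A, fmap (idm X) = idm (fob X);
  fmap_comp : forall (X Y Z : A) (g : hom Y Z) (f : hom X Y),
    fmap (g ∘ f) = fmap g ∘ fmap f
}.

Arguments fmap {A B} _ {X Y} _.

Definition FId (A : Category) : Functor A A.
Proof. now exists (fun X => X) (fun X Y f => f). Defined.

Definition FComp {A B D : Category} (G : Functor B D) (F : Functor A B) :
  Functor A D.
Proof.
exists (fun X => G (F X)) (fun X Y f => fmap G (fmap F f)).
- intros X; now rewrite !fmap_id.
- intros X Y Z g f; now rewrite !fmap_comp.
Defined.

Notation "G ⊙ F" := (FComp G F) : cat_scope.

(* Natural transformations depend only on the object and arrow maps of the two
   functors, not on the proofs of the functor laws.  Hence [H ⊙ (G ⊙ F) ⇒ L]
   and [(H ⊙ G) ⊙ F ⇒ L], or [FId _ ⊙ F ⇒ L] and [F ⇒ L], are convertible, and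
   composites of whiskered transformations need no associators. *)
Record Transformation {A B : Category} (F0 G0 : A -> B)
  (F1 : forall X Y : A, hom X Y -> hom (F0 X) (F0 Y))
  (G1 : forall X Y : A, hom X Y -> hom (G0 X) (G0 Y)) : Type := {
  app :> forall X : A, hom (F0 X) (G0 X);
  naturality : forall (X Y : A) (f : hom X Y),
    app Y ∘ F1 X Y f = G1 X Y f ∘ app X
}.

Definition NatTrans {A B : Category} (F G : Functor A B) : Type :=
  Transformation (@fmap A B F) (@fmap A B G).

Notation "F ⇒ G" := (NatTrans F G) : cat_scope.

Definition vcomp {A B : Category} {F G H : Functor A B}
  (β : G ⇒ H) (α : F ⇒ G) : F ⇒ H.
Proof.
exists (fun X => β X ∘ α X).
intros X Y f.
now rewrite <- comp_assoc, (naturality α), comp_assoc, (naturality β), comp_assoc.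
Defined.

Definition whiskerL {A B D : Category} (H : Functor B D) {F G : Functor A B}
  (α : F ⇒ G) : H ⊙ F ⇒ H ⊙ G.
Proof.
exists (fun X => fmap H (α X)).
intros X Y f; cbn; now rewrite <- !fmap_comp, (naturality α).
Defined.

Definition whiskerR {A B D : Category} {F G : Functor B D} (α : F ⇒ G)
  (H : Functor A B) : F ⊙ H ⇒ G ⊙ H.
Proof.
exists (fun X => α (H X)).
intros X Y f; apply (naturality α).
Defined.

Notation "β • α" := (vcomp β α) : cat_scope.
Notation "F ◁ α" := (whiskerL F α) : cat_scope.
Notation "α ▷ F" := (whiskerR α F) : cat_scope.

Definition Product (A B : Category) : Category.
Proof.
exists (A * B)%type
  (fun X Y => (hom (fst X) (fst Y) * hom (snd X) (snd Y))%type)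
  (fun X => (idm (fst X), idm (snd X)))
  (fun X Y Z g f => (fst g ∘ fst f, snd g ∘ snd f)).
- intros X Y [f1 f2]; cbn; now rewrite !comp_idl.
- intros X Y [f1 f2]; cbn; now rewrite !comp_idr.
- intros W X Y Z h g f; cbn; now rewrite !comp_assoc.
Defined.

Definition Bifunctor (A B D : Category) : Type := Functor (Product A B) D.

Definition biob {A B D : Category} (F : Bifunctor A B D) (X : A) (Y : B) : D :=
  fob F (X, Y).

Definition bimap {A B D : Category} (F : Bifunctor A B D) {X X' : A} {Y Y' : B}
  (f : hom X X') (g : hom Y Y') : hom (biob F X Y) (biob F X' Y') :=
  @fmap (Product A B) D F (X, Y) (X', Y') (f, g).

Definition partial {A B D : Category} (F : Bifunctor A B D) (X : A) :
  Functor B D.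
Proof.
exists (fun Y => biob F X Y) (fun Y Y' g => bimap F (idm X) g).
- intros Y; exact (fmap_id F (X, Y)).
- intros Y Y' Y'' g f; transitivity (bimap F (idm X ∘ idm X) (g ∘ f)).
  { now rewrite comp_idl. }
  exact (@fmap_comp _ _ F (X, Y) (X, Y') (X, Y'') (idm X, g) (idm X, f)).
Defined.

Record MonoidalCategory : Type := {
  mcat :> Category;
  tensor : Bifunctor mcat mcat mcat;
  unitob : mcat;
  assoc : forall X Y Z : mcat,
    hom (biob tensor X (biob tensor Y Z)) (biob tensor (biob tensor X Y) Z);
  lunit : forall X : mcat, hom (biob tensor unitob X) X;
  runit : forall X : mcat, hom (biob tensor X unitob) X;
  assoc_natural : forall (X X' Y Y' Z Z' : mcat)
    (f : hom X X') (g : hom Y Y') (h : hom Z Z'),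
    assoc X' Y' Z' ∘ bimap tensor f (bimap tensor g h)
    = bimap tensor (bimap tensor f g) h ∘ assoc X Y Z;
  lunit_natural : forall (X X' : mcat) (f : hom X X'),
    lunit X' ∘ bimap tensor (idm unitob) f = f ∘ lunit X;
  runit_natural : forall (X X' : mcat) (f : hom X X'),
    runit X' ∘ bimap tensor f (idm unitob) = f ∘ runit X;
  assoc_iso : forall X Y Z : mcat, is_iso (assoc X Y Z);
  lunit_iso : forall X : mcat, is_iso (lunit X);
  runit_iso : forall X : mcat, is_iso (runit X);
  pentagon : forall W X Y Z : mcat,
    assoc (biob tensor W X) Y Z ∘ assoc W X (biob tensor Y Z)
    = bimap tensor (assoc W X Y) (idm Z)
      ∘ assoc W (biob tensor X Y) Z
      ∘ bimap tensor (idm W) (assoc X Y Z);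
  triangle : forall X Y : mcat,
    bimap tensor (runit X) (idm Y) ∘ assoc X unitob Y
    = bimap tensor (idm X) (lunit Y)
}.

Arguments unitob {m}.
Arguments assoc {m} X Y Z.
Arguments lunit {m} X.
Arguments runit {m} X.

Notation "X ⊗ Y" := (biob (tensor _) X Y) : cat_scope.
Notation "f ⊗₁ g" := (bimap (tensor _) f g) : cat_scope.

Record Actegory (V : MonoidalCategory) : Type := {
  acat :> Category;
  action : Bifunctor V acat acat;
  actassoc : forall (Q Q' : V) (N : acat),
    hom (biob action (Q ⊗ Q') N) (biob action Q (biob action Q' N));
  actunit : forall N : acat, hom (biob action unitob N) N;
  actassoc_natural : forall (P P' Q Q' : V) (N N' : acat)
    (f : hom P P') (g : hom Q Q') (h : hom N N'),
    actassoc P' Q' N' ∘ bimap action (f ⊗₁ g) h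
    = bimap action f (bimap action g h) ∘ actassoc P Q N;
  actunit_natural : forall (N N' : acat) (h : hom N N'),
    actunit N' ∘ bimap action (idm unitob) h = h ∘ actunit N;
  actassoc_iso : forall (Q Q' : V) (N : acat), is_iso (actassoc Q Q' N);
  actunit_iso : forall N : acat, is_iso (actunit N);
  actassoc_pentagon : forall (Q Q' Q'' : V) (N : acat),
    actassoc Q Q' (biob action Q'' N)
      ∘ actassoc (Q ⊗ Q') Q'' N
      ∘ bimap action (assoc Q Q' Q'') (idm N)
    = bimap action (idm Q) (actassoc Q' Q'' N) ∘ actassoc Q (Q' ⊗ Q'') N;
  actunit_left : forall (Q : V) (N : acat),
    actunit (biob action Q N) ∘ actassoc unitob Q N
    = bimap action (lunit Q) (idm N);
  actunit_right : forall (Q : V) (N : acat),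
    bimap action (idm Q) (actunit N) ∘ actassoc Q unitob N
    = bimap action (runit Q) (idm N)
}.

Arguments action {V} a.
Arguments actassoc {V a} Q Q' N.
Arguments actunit {V a} N.

Notation "Q ◊ N" := (biob (action _) Q N) : cat_scope.
Notation "f ◊₁ g" := (bimap (action _) f g) : cat_scope.

Definition act {V : MonoidalCategory} (N : Actegory V) (C : V) : Functor N N :=
  partial (action N) C.

Record Colax {V : MonoidalCategory} {M N : Actegory V} (F : Functor M N) :
  Type := {
  zeta :> forall (C : V) (X : M), hom (F (C ◊ X)) (C ◊ F X);
  zeta_binatural : forall (C C' : V) (X X' : M) (c : hom C C') (f : hom X X'),
    zeta C' X' ∘ fmap F (c ◊₁ f) = (c ◊₁ fmap F f) ∘ zeta C X;
  zeta_unit : forall X : M,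
    actunit (F X) ∘ zeta unitob X = fmap F (actunit X);
  zeta_tensor : forall (A B : V) (X : M),
    actassoc A B (F X) ∘ zeta (A ⊗ B) X
    = (idm A ◊₁ zeta B X) ∘ zeta A (B ◊ X) ∘ fmap F (actassoc A B X)
}.

Definition colaxAt {V : MonoidalCategory} {M N : Actegory V} {F : Functor M N}
  (ζ : Colax F) (C : V) : F ⊙ act M C ⇒ act N C ⊙ F.
Proof.
exists (fun X => ζ C X).
intros X Y f; exact (zeta_binatural ζ (idm C) f).
Defined.

Record Monad (A : Category) : Type := {
  mfun :> Functor A A;
  mu : mfun ⊙ mfun ⇒ mfun;
  eta : FId A ⇒ mfun;
  mu_assoc : forall X : A, mu X ∘ fmap mfun (mu X) = mu X ∘ mu (mfun X);
  mu_etal : forall X : A, mu X ∘ eta (mfun X) = idm (mfun X);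
  mu_etar : forall X : A, mu X ∘ fmap mfun (eta X) = idm (mfun X)
}.

Arguments mu {A} m.
Arguments eta {A} m.

Record DistributiveLaw {V : MonoidalCategory} {M : Actegory V} (S : Monad M) :
  Type := {
  law :> Colax (M := M) (N := M) S;
  law_mu : forall (C : V) (X : M),
    law C X ∘ mu S (C ◊ X)
    = (idm C ◊₁ mu S X) ∘ law C (S X) ∘ fmap S (law C X);
  law_eta : forall (C : V) (X : M),
    law C X ∘ eta S (C ◊ X) = idm C ◊₁ eta S X
}.

Record MapOfPairs {V : MonoidalCategory} {M N : Actegory V}
  {T : Monad N} (lT : DistributiveLaw T) {S : Monad M} (lS : DistributiveLaw S) :
  Type := {
  mapfun :> Functor M N;
  mapzeta : Colax mapfun;
  mapalpha : T ⊙ mapfun ⇒ mapfun ⊙ S;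
  mapalpha_mu :
    mapalpha • (mu T ▷ mapfun)
    = (mapfun ◁ mu S) • (mapalpha ▷ S) • (T ◁ mapalpha)
      :> (T ⊙ T ⊙ mapfun ⇒ mapfun ⊙ S);
  mapalpha_eta :
    mapalpha • (eta T ▷ mapfun) = mapfun ◁ eta S
      :> (mapfun ⇒ mapfun ⊙ S);
  mapalpha_law : forall C : V,
    (act N C ◁ mapalpha) • (colaxAt lT C ▷ mapfun) • (T ◁ colaxAt mapzeta C)
    = (colaxAt mapzeta C ▷ S) • (mapfun ◁ colaxAt lS C) • (mapalpha ▷ act M C)
      :> (T ⊙ mapfun ⊙ act M C ⇒ act N C ⊙ mapfun ⊙ S)
}.

(* Main.v *)
Require Import Defs.
From Stdlib Require Import FunctionalExtensionality ProofIrrelevance.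
Open Scope cat_scope.

(** The natural transformation [χ = Kμ ∘ αS] is compatible with the distributive
    laws because each of its two factors is.  At an object [X], the
    compatibility of [α] with [lT], [lS] and [ζ], taken at [S X], turns the
    left-hand side into
    [GN Kμ ∘ ζ_SSX ∘ K lS_SX ∘ α_(C ◊ SX) ∘ TK lS_X].
    Naturality of [α] at [lS_X] moves [α] to the far right, naturality of [ζ]
    at [μ_X] moves [ζ] to the far left, and what remains between them, under
    [K], is the right-hand side of the compatibility of [lS] with [μ]
    ([law_mu]).  This computation is [mult_alpha_law_at]; it takes place in the
    hom-sets of [N], and [transformation_ext] lifts it to an equality of natural
    transformations. *)

(** Function extensionality identifies the components, proof irrelevance the
    naturality proofs. *)
Lemma transformation_ext {A B : Category} {F0 G0 : A -> B}
  {F1 : forall X Y : A, hom X Y -> hom (F0 X) (F0 Y)}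
  {G1 : forall X Y : A, hom X Y -> hom (G0 X) (G0 Y)}
  (σ τ : Transformation F1 G1) :
  (forall X : A, σ X = τ X) -> σ = τ.
Proof.
destruct σ as [s ns], τ as [t nt]; cbn; intros E.
apply functional_extensionality_dep in E; destruct E.
now rewrite (proof_irrelevance _ ns nt).
Qed.

Section MapOfPairs.

Context {V : MonoidalCategory} {M N : Actegory V} {S : Monad M} {T : Monad N}
  {lS : DistributiveLaw S} {lT : DistributiveLaw T} (K : MapOfPairs lT lS).

Lemma mapalpha_law_at (C : V) (X : M) :
  (idm C ◊₁ mapalpha K X) ∘ lT C (K X) ∘ fmap T (mapzeta K C X)
  = mapzeta K C (S X) ∘ fmap K (lS C X) ∘ mapalpha K (C ◊ X).
Proof.
exact (f_equal (fun τ : T ⊙ K ⊙ act M C ⇒ act N C ⊙ K ⊙ S => τ X)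
  (mapalpha_law K C)).
Qed.

Lemma mapalpha_natural {X Y : M} (f : hom X Y) :
  mapalpha K Y ∘ fmap T (fmap K f) = fmap K (fmap S f) ∘ mapalpha K X.
Proof. exact (naturality (mapalpha K) f). Qed.

Lemma act_comp (C : V) {X Y Z : N} (g : hom Y Z) (f : hom X Y) :
  idm C ◊₁ (g ∘ f) = (idm C ◊₁ g) ∘ (idm C ◊₁ f).
Proof. exact (fmap_comp (act N C) g f). Qed.

Lemma mult_alpha_law_at (C : V) (X : M) :
  (idm C ◊₁ (fmap K (mu S X) ∘ mapalpha K (S X)))
    ∘ lT C (K (S X)) ∘ fmap T (mapzeta K C (S X)) ∘ fmap T (fmap K (lS C X))
  = mapzeta K C (S X) ∘ fmap K (lS C X)
    ∘ (fmap K (mu S (C ◊ X)) ∘ mapalpha K (S (C ◊ X))).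
Proof.
transitivity
  ((idm C ◊₁ fmap K (mu S X))
   ∘ (mapzeta K C (S (S X)) ∘ fmap K (lS C (S X)) ∘ mapalpha K (C ◊ S X))
   ∘ fmap T (fmap K (lS C X))).
{ rewrite <- mapalpha_law_at, act_comp; now rewrite !comp_assoc. }
transitivity
  ((idm C ◊₁ fmap K (mu S X)) ∘ mapzeta K C (S (S X))
   ∘ fmap K (lS C (S X) ∘ fmap S (lS C X)) ∘ mapalpha K (S (C ◊ X))).
{ rewrite fmap_comp, <- !comp_assoc.
  (* The hidden middle objects, such as [(act M C ⊙ S) X] and [C ◊ S X], agree
     only up to conversion, which [exact] sees through and [rewrite] does not. *)
  do 3 apply f_equal.
  exact (mapalpha_natural (lS C X)). }
transitivity
  (mapzeta K C (S X)
   ∘ fmap K ((idm C ◊₁ mu S X) ∘ lS C (S X) ∘ fmap S (lS C X))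
   ∘ mapalpha K (S (C ◊ X))).
{ rewrite <- (comp_assoc (idm C ◊₁ mu S X)).
  rewrite (fmap_comp K (idm C ◊₁ mu S X)), comp_assoc.
  do 2 apply (f_equal (fun h => h ∘ _)).
  exact (eq_sym (zeta_binatural (mapzeta K) (idm C) (mu S X))). }
rewrite <- law_mu, fmap_comp; now rewrite !comp_assoc.
Qed.

End MapOfPairs.

Theorem mainTheorem2 (V : MonoidalCategory) (M N : Actegory V)
  (S : Monad M) (T : Monad N)
  (lS : DistributiveLaw S) (lT : DistributiveLaw T)
  (K : MapOfPairs lT lS) (C : V) :
  let GM : Functor M M := act M C in
  let GN : Functor N N := act N C in
  let α : T ⊙ K ⇒ K ⊙ S := mapalpha K in
  let ζ : K ⊙ GM ⇒ GN ⊙ K := colaxAt (mapzeta K) C in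
  let lSC : S ⊙ GM ⇒ GM ⊙ S := colaxAt lS C in
  let lTC : T ⊙ GN ⇒ GN ⊙ T := colaxAt lT C in
  let χ : T ⊙ K ⊙ S ⇒ K ⊙ S := (K ◁ mu S) • (α ▷ S) in
  (GN ◁ χ) • (lTC ▷ (K ⊙ S)) • (T ◁ (ζ ▷ S)) • (T ◁ (K ◁ lSC))
  = (ζ ▷ S) • (K ◁ lSC) • (χ ▷ GM)
    :> (T ⊙ K ⊙ S ⊙ GM ⇒ GN ⊙ K ⊙ S).
Proof.
intros GM GN α ζ lSC lTC χ.
apply transformation_ext; intros X.
exact (mult_alpha_law_at K C X).
Qed.
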